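(* Let $d\ge2$ be an integer and let $\Theta$ be a non-empty open subset of the unit sphere $\mathbb{S}^{d-1}\subset\mathbb{R}^d$. Let $n,m\in\mathbb{N}$, let $y_1,\dots,y_n\in\mathbb{R}^d$ be mutually distinct and $c_1,\dots,c_n\in\mathbb{C}\setminus\{0\}$, and let $z_1,\dots,z_m\in\mathbb{R}^d$ be mutually distinct and $b_1,\dots,b_m\in\mathbb{C}\setminus\{0\}$. If $$\sum_{j=1}^{n}c_je^{iy_j\cdot\theta}=\sum_{j=1}^{m}b_je^{iz_j\cdot\theta}\qquad\text{for all }\theta\in\Theta,$$ then $\{(y_j,c_j):1\le j\le n\}=\{(z_j,b_j):1\le j\le m\}$ (in particular $n=m$). In other words, for $u(\theta)=\sum_{j=1}^nc_je^{iy_j\cdot\theta}$, $\theta\in\mathbb{S}^{d-1}$, the $y_j$'s and $c_j$'s are uniquely determined (up to relabeling) by $u$ on $\Theta$.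
   Context: $\mathbb{S}^{d-1}=\{\theta\in\mathbb{R}^d:|\theta|=1\}$, ''open'' means relatively open in $\mathbb{S}^{d-1}$, and $y\cdot\theta$ is the standard Euclidean inner product. Here $\mathbb{N}$ is taken to include $0$, the empty sum being the zero function. *)

(* Defs.v *)
From mathcomp Require Import all_boot all_order all_algebra.
From mathcomp Require Import all_classical all_reals all_analysis.
From mathcomp Require Import complex.
Import Order.TTheory GRing.Theory Num.Theory.
Import numFieldNormedType.Exports.

Set Implicit Arguments.
Unset Strict Implicit.
Unset Printing Implicit Defensive.

Local Open Scope classical_set_scope.
Local Open Scope ring_scope.
Local Open Scope complex_scope.

Definition dotv (R : realType) (d : nat) (x y : 'rV[R]_d) : R :=
  \sum_(k < d) x ord0 k * y ord0 k.

(* The library's norm `|x| on 'rV[R]_d is the sup norm, hence this definition;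
   the topologies induced by the two norms coincide. *)
Definition enorm (R : realType) (d : nat) (x : 'rV[R]_d) : R :=
  Num.sqrt (dotv x x).

(* In R^d, i.e. the sphere S^(d-1). *)
Definition unit_sphere (R : realType) (d : nat) : set 'rV[R]_d :=
  [set x | enorm x = 1].
Arguments unit_sphere : clear implicits.

Definition relatively_open (T : topologicalType) (S A : set T) : Prop :=
  exists2 U : set T, open U & A = U `&` S.

(* exp (a + i b) = exp a * (cos b + i sin b). *)
Definition cexp (R : realType) (w : R[i]) : R[i] :=
  (expR (complex.Re w))%:C *
  (cos (complex.Im w) +i* sin (complex.Im w)).

Definition exp_sum (R : realType) (d n : nat)
    (y : 'I_n -> 'rV[R]_d) (c : 'I_n -> R[i]) (theta : 'rV[R]_d) : R[i] :=
  \sum_(j < n) c j * cexp ('i%C * (dotv (y j) theta)%:C).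

(* Main.v *)
(* Cut the sphere by a great circle t |-> cos t *: x + sin t *: e through a
   point x of Theta, the direction e being chosen so that the points
   p_j = y_j.x + i y_j.e of the plane remain distinct.  On this circle
   exp(i y_j.theta) becomes exp(i Re(conj p_j w)) with w = exp(i t), and it
   suffices to show that these functions are linearly independent near t = 0
   even over the polynomials in w.  Given a relation
   sum_p A_p(w) exp(i Re(conj p w)) = 0, divide by the term of one frequency q
   and differentiate in w more than deg A_q times: the q-th term disappears,
   whereas for p <> q each differentiation (followed by multiplication by w^2)
   raises the degree of A_p by exactly 2.  Induction on the number of
   frequencies concludes, without analytic continuation. *)
Require Import Defs.
From mathcomp Require Import all_boot all_order all_algebra.
From mathcomp Require Import all_classical all_reals all_analysis.
From mathcomp Require Import complex ring lra.
Import Order.TTheory GRing.Theory Num.Theory.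
Import numFieldNormedType.Exports.

Set Implicit Arguments.
Unset Strict Implicit.
Unset Printing Implicit Defensive.

Local Open Scope classical_set_scope.
Local Open Scope ring_scope.
Local Open Scope complex_scope.

(** * Derivatives of complex-valued functions of a real variable *)

Section ComplexDerivative.
Variable R : realType.
Implicit Types (t : R) (f g : R -> R[i]) (l k a : R[i]).

(** Componentwise, so that the rules for real derivatives, in particular those of [cos] and [sin],
    apply to each part. *)
Definition is_cderive t f l : Prop :=
  is_derive t 1 (fun s => complex.Re (f s)) (complex.Re l) /\
  is_derive t 1 (fun s => complex.Im (f s)) (complex.Im l).

Lemma is_cderive_eq t f l k : is_cderive t f l -> l = k -> is_cderive t f k.
Proof. by move=> ? <-. Qed.

Lemma is_cderive_cst t a : is_cderive t (fun=> a) 0.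
Proof. by split; apply: is_derive_cst. Qed.

Lemma is_cderiveD t f g l k : is_cderive t f l -> is_cderive t g k ->
  is_cderive t (fun s => f s + g s) (l + k).
Proof.
move=> [fr fi] [gr gi]; split.
- have -> : (fun s => complex.Re (f s + g s)) =
    (fun s => complex.Re (f s)) + (fun s => complex.Re (g s)).
    by apply/funext => s; rewrite /= /GRing.add /=; case: (f s); case: (g s).
  by apply: is_derive_eq; case: (l); case: (k).
- have -> : (fun s => complex.Im (f s + g s)) =
    (fun s => complex.Im (f s)) + (fun s => complex.Im (g s)).
    by apply/funext => s; rewrite /= /GRing.add /=; case: (f s); case: (g s).
  by apply: is_derive_eq; case: (l); case: (k).
Qed.

Lemma is_cderiveM t f g l k : is_cderive t f l -> is_cderive t g k ->
  is_cderive t (fun s => f s * g s) (f t * k + l * g t).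
Proof.
move=> [fr fi] [gr gi]; split.
- have -> : (fun s => complex.Re (f s * g s)) =
    (fun s => complex.Re (f s)) * (fun s => complex.Re (g s)) -
    (fun s => complex.Im (f s)) * (fun s => complex.Im (g s)).
    by apply/funext => s /=; rewrite !fctE; case: (f s); case: (g s).
  apply: is_derive_eq; rewrite /GRing.scale /=.
  by case: (l) (k) (f t) (g t) => [a b] [c d] [u v] [x y] /=; ring.
- have -> : (fun s => complex.Im (f s * g s)) =
    (fun s => complex.Re (f s)) * (fun s => complex.Im (g s)) +
    (fun s => complex.Im (f s)) * (fun s => complex.Re (g s)).
    by apply/funext => s /=; rewrite !fctE; case: (f s); case: (g s).
  apply: is_derive_eq; rewrite /GRing.scale /=.
  by case: (l) (k) (f t) (g t) => [a b] [c d] [u v] [x y] /=; ring.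
Qed.

Lemma is_cderive_sum t (I : Type) (s : seq I) (F : I -> R -> R[i])
    (L : I -> R[i]) :
  (forall i, is_cderive t (F i) (L i)) ->
  is_cderive t (fun x => \sum_(i <- s) F i x) (\sum_(i <- s) L i).
Proof.
move=> dF; elim: s => [|i s IHs].
  rewrite big_nil (_ : (fun _ => _) = fun=> 0); first exact: is_cderive_cst.
  by apply/funext => x; rewrite big_nil.
rewrite big_cons (_ : (fun _ => _) = fun x => F i x + \sum_(j <- s) F j x).
  exact: is_cderiveD.
by apply/funext => x; rewrite big_cons.
Qed.

Lemma is_cderive_horner t f l (P : {poly R[i]}) : is_cderive t f l ->
  is_cderive t (fun s => P.[f s]) (P^`().[f t] * l).
Proof.
move=> df; elim/poly_ind: P => [|P a IHP].
  rewrite (_ : (fun _ => _) = fun=> 0).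
    by rewrite deriv0 horner0 mul0r; exact: is_cderive_cst.
  by apply/funext => s; rewrite horner0.
rewrite (_ : (fun _ => _) = fun s => P.[f s] * f s + a); last first.
  by apply/funext => s; rewrite !hornerE.
apply: is_cderive_eq.
  exact: is_cderiveD (is_cderiveM IHP df) (is_cderive_cst _ a).
by rewrite derivMXaddC !hornerE; ring.
Qed.

Lemma is_cderive_near0 t f l : (\near t, f t = 0) -> is_cderive t f l -> l = 0.
Proof.
move=> f0 [fr fi].
have d0 (h : R -> R) m : (\near t, h t = 0) -> is_derive t 1 h m -> m = 0.
  move=> h0 dh.
  have d0 : is_derive t 1 h 0.
    apply: (near_eq_is_derive (f := cst 0)).
    by near=> s; rewrite /cst (near h0 s).
  by rewrite -(@derive_val _ _ _ _ _ _ _ dh) (@derive_val _ _ _ _ _ _ _ d0).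
apply/eqP; rewrite eq_complex; apply/andP; split; apply/eqP => /=.
- by apply: d0 fr; near=> s; rewrite (near f0 s).
- by apply: d0 fi; near=> s; rewrite (near f0 s).
Unshelve. all: by end_near. Qed.

(** * Points of the unit circle and phases of frequencies *)

Definition cis (x : R) : R[i] := cos x +i* sin x.

Lemma cis0 : cis 0 = 1.
Proof. by rewrite /cis cos0 sin0. Qed.

Lemma cisD (x y : R) : cis (x + y) = cis x * cis y.
Proof.
rewrite /cis cosD sinD; apply/eqP; rewrite eq_complex /=.
by apply/andP; split; apply/eqP; ring.
Qed.

Lemma cis_neq0 (x : R) : cis x != 0.
Proof.
apply/eqP => c0; have := oner_neq0 R[i].
by rewrite -cis0 -(subrr x) cisD c0 mul0r eqxx.
Qed.

Lemma is_cderive_cis t (h : R -> R) (m : R) : is_derive t 1 h m ->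
  is_cderive t (fun s => cis (h s)) ('i%C * m%:C * cis (h t)).
Proof.
move=> dh; split => /=.
- have := is_derive1_comp (is_derive_cos (h t)) dh.
  by move/is_derive_eq; apply; ring.
- have := is_derive1_comp (is_derive_sin (h t)) dh.
  by move/is_derive_eq; apply; ring.
Qed.

Lemma cexp_i (x : R) : cexp ('i%C * x%:C) = cis x.
Proof.
by rewrite /cexp /= !mul0r mul1r subrr add0r mul1r expR0 [1%:C]rmorph1 mul1r.
Qed.

Definition phase (p : R[i]) (t : R) : R :=
  complex.Re p * cos t + complex.Im p * sin t.

(* With w = cis t and phase p t = Re (conj p * w), this polynomial in w is
   w * d(phase p)/dt, the factor w clearing the denominator of sin and cos. *)
Definition phase_poly (p : R[i]) : {poly R[i]} :=
  ('i%C / 2) *: (conjc p *: 'X^2 - p%:P).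

Lemma is_derive_phase (p : R[i]) t : is_derive t 1 (phase p)
  (complex.Im p * cos t - complex.Re p * sin t).
Proof.
rewrite (_ : phase p =
    (complex.Re p \*: (cos : R -> R)) + (complex.Im p \*: (sin : R -> R))).
  by apply: is_derive_eq; rewrite /GRing.scale /=; ring.
by apply/funext => s.
Qed.

Lemma horner_phase_poly (p : R[i]) t : (phase_poly p).[cis t] =
  cis t * (complex.Im p * cos t - complex.Re p * sin t)%:C.
Proof.
have E : cos t ^+ 2 + sin t ^+ 2 = 1 :> R by exact: cos2Dsin2.
have two : (2 : R[i])^-1 = (2^-1)%:C by rewrite fmorphV rmorph_nat.
rewrite /phase_poly !hornerE two /cis; case: p => a b.
(* Multiplying the Pythagorean identity by a and by b leaves goals that are linear in the monomials,
   within reach of [lra]. *)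
have Ea : a * (cos t ^+ 2 + sin t ^+ 2) = a by rewrite E mulr1.
have Eb : b * (cos t ^+ 2 + sin t ^+ 2) = b by rewrite E mulr1.
by apply/eqP; rewrite eq_complex /=; apply/andP; split; apply/eqP; lra.
Qed.

End ComplexDerivative.

(** * Independence on a circle *)

Section CircleIndependence.
Variable R : realType.
Implicit Types (s : seq R[i]) (p q : R[i]) (A B : R[i] -> {poly R[i]}).

Definition vanishes_near0 s A : Prop :=
  \forall t \near (0 : R), \sum_(p <- s) (A p).[cis t] * cis (phase p t) = 0.

(* For Q = phase_poly p, the coefficient of cis (phase p t) in
   (-i w d/dt - G(w)) (P(w) cis (phase p t)), w = cis t.  With
   G = phase_poly q + 2k X this is w^(2k+2) d/dw w^(-2k) conjugated by the
   exponential of frequency q. *)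
Definition phase_deriv (G P Q : {poly R[i]}) : {poly R[i]} :=
  P^`() * 'X^2 + (Q - G) * P.

Lemma vanishes_near0_deriv s A (G : {poly R[i]}) : vanishes_near0 s A ->
  vanishes_near0 s (fun p => phase_deriv G (A p) (phase_poly p)).
Proof.
(* For t near 0 the relation holds on a whole neighbourhood of t, so it can be differentiated at
   t. *)
move=> /nbhs_interior; rewrite /vanishes_near0; apply: filterS => t A1.
have dF : is_cderive t
    (fun u => \sum_(p <- s) (A p).[cis u] * cis (phase p u))
    (\sum_(p <- s) ((A p).[cis t] * ('i%C *
        (complex.Im p * cos t - complex.Re p * sin t)%:C * cis (phase p t)) +
      (A p)^`().[cis t] * ('i%C * 1%:C * cis t) * cis (phase p t))).
  apply: is_cderive_sum => p; apply: is_cderiveM.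
    by apply/is_cderive_horner/is_cderive_cis.
  exact/is_cderive_cis/is_derive_phase.
have {}dF := is_cderive_near0 A1 dF.
have At := nbhs_singleton A1.
have i2 : 'i%C * 'i%C = -1 :> R[i] by rewrite -expr2 sqr_i.
have comb (a b x y : R[i]) : x = 0 -> y = 0 -> a * x - b * y = 0.
  by move=> -> ->; rewrite !mulr0 subr0.
(* Since dw/dt = i w, the factor -i w turns d/dt into w^2 d/dw on the polynomial coefficients. *)
rewrite -[RHS](comb (- 'i%C * cis t) G.[cis t] _ _ dF At).
rewrite !mulr_sumr -sumrB; apply: eq_bigr => p _.
rewrite /phase_deriv !(hornerM, hornerD, hornerN, hornerX).
rewrite horner_phase_poly [1%:C]rmorph1; ring: i2.
Qed.

Lemma phase_deriv_neq0 (P : {poly R[i]}) p q (k : R[i]) : p != q -> P != 0 ->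
  phase_deriv (phase_poly q + k *: 'X) P (phase_poly p) != 0.
Proof.
move=> pq P0; rewrite /phase_deriv; apply/eqP.
move=> /(congr1 (fun S : {poly R[i]} => S`_(size P).+1)).
(* The coefficient of degree deg P + 2 is lead_coef P times that of
   'X^2 in phase_poly p - phase_poly q. *)
have [n Pn] : exists n, size P = n.+1.
  by exists (size P).-1; rewrite prednK // size_poly_gt0.
have -> : phase_poly p - (phase_poly q + k *: 'X) =
    ('i%C / 2 * (p^* - q^*)) *: 'X^2 - k *: 'X + ('i%C / 2 * (q - p))%:P.
  rewrite /phase_poly -!mul_polyC !polyCM !polyCB.
  by ring.
rewrite coef0 coefD coefMXn !mulrDl !coefD mulNr coefN.
rewrite -!scalerAl mul_polyC !coefZ -!(commr_polyXn, commr_polyX).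
rewrite coefMX coefMXn coef_deriv Pn /= !subSS subn0.
(* Here P has degree n, and the derivative, the [k] term and the constant term contribute only
   through the next two coefficients, which vanish. *)
rewrite [P`_n.+1]nth_default ?Pn //.
rewrite [P`_n.+2]nth_default ?Pn //.
rewrite mul0rn !mulr0 subr0 addr0 add0r => /eqP.
rewrite !mulf_eq0 invr_eq0 pnatr_eq0 /= orbF => /orP[/orP[]|].
- by rewrite -sqrf_eq0 sqr_i oppr_eq0 oner_eq0.
- by rewrite -rmorphB conjc_eq0 subr_eq0 (negPf pq).
- have -> : P`_n = lead_coef P by rewrite lead_coefE Pn.
  by rewrite lead_coef_eq0 (negPf P0).
Qed.

(** Iterates [phase_deriv] with k = 0, 2, ..., 2(n - 1). At frequency q the phase polynomials
    cancel, and the choice k = 2j cancels the derivative of X^(2j): X^2 (P X^(2j))' - 2j X P X^(2j)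
    = P' X^(2j+2). *)
Lemma vanishes_near0_derivn s A q n : uniq (q :: s) ->
  vanishes_near0 (q :: s) A ->
  exists B, [/\ vanishes_near0 (q :: s) B,
    forall p, p \in s -> A p != 0 -> B p != 0 &
    B q = (A q)^`(n) * 'X^(2 * n)].
Proof.
move=> /= /andP[qs _] A0; elim: n => [|n [B [B0 sB Bq]]].
  by exists A; split=> //; rewrite derivn0 muln0 expr0 mulr1.
exists (fun p => phase_deriv (phase_poly q + (2 * n)%:R *: 'X) (B p)
  (phase_poly p)); split.
- exact: vanishes_near0_deriv.
- move=> p ps /(sB _ ps); apply: phase_deriv_neq0.
  by apply: contraNneq qs => <-.
- rewrite Bq /phase_deriv derivM derivXn -derivnS opprD addrA subrr add0r.
  rewrite (_ : 2 * n.+1 = 2 + 2 * n)%N ?mulnS // exprD.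
  (* The exponent 2n - 1 in the derivative of X^(2n) is truncated at n = 0, where its factor 2n
     vanishes. *)
  case: n {B B0 sB Bq} => [|n].
    by rewrite muln0 scale0r expr0 mulr0n; ring.
  rewrite (_ : 'X^(2 * n.+1) = 'X * 'X^((2 * n.+1).-1)); last first.
    by rewrite -exprS mulnS.
  by rewrite -mulr_natr scaler_nat -mulr_natr; ring.
Qed.

Lemma circle_independence s A : uniq s -> vanishes_near0 s A ->
  forall p, p \in s -> A p = 0.
Proof.
elim: s A => // q s IHs A uqs A0.
have As p : p \in s -> A p = 0.
  (* This many derivatives annihilate [A q], so the induction hypothesis applies to [B] on [s]; a
     nonzero [A p] would leave [B p] nonzero. *)
  move=> ps; have [B [B0 sB Bq]] := vanishes_near0_derivn (size (A q)) uqs A0.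
  have {}B0 : vanishes_near0 s B.
    apply: filterS B0 => t; rewrite big_cons Bq.
    by rewrite (derivn_poly0 (leqnn _)) mul0r horner0 mul0r add0r.
  apply/eqP/negPn/negP => /(sB _ ps); rewrite IHs ?eqxx //.
  by case/andP: uqs.
move=> p; rewrite inE => /orP[/eqP->{p}|/As //].
apply/eqP/negPn/negP => Aq.
have Aq0 : vanishes_near0 [:: q] A.
  apply: filterS A0 => t; rewrite !big_cons big_nil [X in _ + X]big1_seq //.
  by move=> p /= ps; rewrite As // horner0 mul0r.
have [n An] : exists n, size (A q) = n.+1.
  by exists (size (A q)).-1; rewrite prednK // size_poly_gt0.
(* With n the degree of [A q], the n-th derivative is n! times the leading coefficient; the relation
   at t = 0, where w = 1, makes it zero. *)
have [B [/nbhs_singleton B0 _ Bq]] :=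
  vanishes_near0_derivn n (isT : uniq [:: q]) Aq0.
move: B0; rewrite big_seq1 Bq hornerM hornerXn cis0 expr1n mulr1 => /eqP.
rewrite mulf_eq0 (negPf (cis_neq0 _)) orbF.
have -> : (A q)^`(n) = (lead_coef (A q) *+ n`!)%:P.
  apply/polyP => i; rewrite coef_derivn coefC lead_coefE An.
  case: i => [|i]; first by rewrite addn0 ffactnn.
  by rewrite nth_default ?mul0rn // An addnS ltnS leq_addr.
rewrite hornerC -mulr_natr mulf_eq0 lead_coef_eq0 (negPf Aq) /=.
by rewrite pnatr_eq0 gtn_eqF ?fact_gt0.
Qed.

End CircleIndependence.

(** * Independence on the sphere *)

Section Sphere.
Variables (R : realType) (d : nat).
Implicit Types (x y e : 'rV[R]_d) (t : R).

Lemma dotvC x y : dotv x y = dotv y x.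
Proof. by apply: eq_bigr => k _; rewrite mulrC. Qed.

Lemma dotvDr x y e : dotv x (y + e) = dotv x y + dotv x e.
Proof. by rewrite -big_split; apply: eq_bigr => k _; rewrite mxE mulrDr. Qed.

Lemma dotvZr t x y : dotv x (t *: y) = t * dotv x y.
Proof. by rewrite mulr_sumr; apply: eq_bigr => k _; rewrite mxE mulrCA. Qed.

Lemma dotvBr x y e : dotv x (y - e) = dotv x y - dotv x e.
Proof. by rewrite dotvDr -scaleN1r dotvZr mulN1r. Qed.

Lemma dotv_ge0 x : 0 <= dotv x x.
Proof. by apply: sumr_ge0 => k _; rewrite -expr2 sqr_ge0. Qed.

Lemma unit_sphereE x : unit_sphere R d x <-> dotv x x = 1.
Proof.
rewrite /unit_sphere /enorm /=; split=> [x1|->]; last exact: sqrtr1.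
by rewrite -[LHS]sqr_sqrtr ?dotv_ge0 // x1 expr1n.
Qed.

Lemma exists_nonroot (P : {poly R}) : P != 0 -> exists t, P.[t] != 0.
Proof.
move=> P0; apply/not_existsP => Pr.
suff : (size P < size P)%N by rewrite ltnn.
have := @max_poly_roots _ P [seq i%:R | i <- iota 0 (size P)] P0.
rewrite size_map size_iota; apply.
- by apply/allP => t _; rewrite rootE; apply/negPn/negP/Pr.
- rewrite map_inj_uniq ?iota_uniq // => i j /eqP.
  by rewrite eqr_nat => /eqP.
Qed.

Lemma exists_nonorthogonal (s : seq 'rV[R]_d) :
  exists e, forall x, x \in s -> x != 0 -> dotv x e != 0.
Proof.
(* A nonroot of the product avoids the roots of all the factors at once. *)
have [t] : exists t, (\prod_(x <- s | x != 0) rVpoly x).[t] != 0.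
  apply: exists_nonroot; rewrite prodf_seq_neq0; apply/allP => x _.
  apply/implyP; apply: contraNneq => x0.
  by rewrite -(rVpolyK x) x0 linear0.
rewrite horner_prod prodf_seq_neq0 => /allP st.
(* On the moment curve, dotv x e is the value at t of the polynomial with
   coefficient vector x. *)
exists (\row_k t ^+ k) => x /st /implyP xt /xt.
rewrite (_ : dotv _ _ = (rVpoly x).[t]) // horner_poly.
by apply: eq_bigr => k _; rewrite valK mxE.
Qed.


Lemma dotv_eq0 x : (dotv x x == 0) = (x == 0).
Proof.
apply/eqP/eqP => [x0|->]; last by apply: big1 => k _; rewrite !mxE mul0r.
apply/rowP => k; rewrite mxE; apply/eqP; rewrite -sqrf_eq0 expr2.
by apply/eqP/(psumr_eq0P _ x0) => // i _; rewrite -expr2 sqr_ge0.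
Qed.

(** The column [x^T] has rank at most 1 < d, so its left kernel is nonzero. *)
Lemma exists_orthogonal x : (2 <= d)%N -> exists2 u, u != 0 & dotv u x = 0.
Proof.
move=> d2; exists (nz_row (kermx x^T)).
  rewrite nz_row_eq0 -mxrank_eq0 mxrank_ker subn_eq0 -ltnNge.
  by rewrite (leq_ltn_trans (rank_leq_col _)).
have /sub_kermxP ux := nz_row_sub (kermx x^T).
transitivity ((nz_row (kermx x^T) *m x^T) 0 0); last by rewrite ux mxE.
by rewrite mxE; apply: eq_bigr => k _; rewrite [x^T _ _]mxE.
Qed.

(** Projecting a generic vector off x does not change its product with any v orthogonal to x. The
    other v are already detected by their product with x. *)
Lemma exists_separating_tangent x (s : seq 'rV[R]_d) : (2 <= d)%N ->
  dotv x x = 1 -> exists e, [/\ dotv e e = 1, dotv x e = 0 &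
    forall v, v \in s -> v != 0 -> dotv v x = 0 -> dotv v e != 0].
Proof.
move=> d2 x1; have [u u0 ux] := exists_orthogonal x d2.
(* Including u in the list forces the tangential part of e to be nonzero. *)
have [e es] := exists_nonorthogonal (u :: s).
pose f := e - dotv x e *: x.
have vf v : v \in u :: s -> v != 0 -> dotv v x = 0 -> dotv v f != 0.
  by move=> vs v0 vx; rewrite dotvBr dotvZr vx mulr0 subr0 es.
have f0 : 0 < dotv f f.
  rewrite lt_def dotv_ge0 dotv_eq0 andbT; apply: contra_neq (vf u _ u0 ux).
    by move=> ->; rewrite -(scale0r u) dotvZr mul0r.
  exact: mem_head.
exists ((Num.sqrt (dotv f f))^-1 *: f); split=> [||v vs v0 vx].
- rewrite dotvZr dotvC dotvZr mulrA -expr2 exprVn sqr_sqrtr ?dotv_ge0 //.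
  by rewrite mulVf // gt_eqF.
- by rewrite dotvZr [dotv x f]dotvBr dotvZr x1 mulr1 subrr mulr0.
- rewrite dotvZr; apply: mulf_neq0.
    by rewrite invr_eq0 gt_eqF // sqrtr_gt0.
  by rewrite vf // inE vs orbT.
Qed.

Lemma near_great_circle (U : set 'rV[R]_d) x e : open U -> U x ->
  \forall t \near (0 : R), U (cos t *: x + sin t *: e).
Proof.
move=> Uo Ux.
have : (fun t : R => cos t *: x + sin t *: e) @ (0 : R) -->
    cos (0 : R) *: x + sin (0 : R) *: e.
  by apply: cvgD; apply: cvgZr_tmp;
    [exact: continuous_cos|exact: continuous_sin].
rewrite cos0 sin0 scale1r scale0r addr0; apply.
exact: open_nbhs_nbhs.
Qed.

Lemma sphere_independence (Theta : set 'rV[R]_d) (s : seq 'rV[R]_d)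
    (C : 'rV[R]_d -> R[i]) : (2 <= d)%N ->
  Theta !=set0 -> relatively_open (unit_sphere R d) Theta -> uniq s ->
  (forall theta, Theta theta ->
     \sum_(x <- s) C x * cexp ('i%C * (dotv x theta)%:C) = 0) ->
  forall x, x \in s -> C x = 0.
Proof.
move=> d2 [x Tx] [U Uo TU] us Cs.
have [Ux /unit_sphereE x1] : U x /\ unit_sphere R d x by move: Tx; rewrite TU.
(* Applied to differences, so that x and e together separate the points of [s]. *)
have [e [e1 xe es]] :=
  exists_separating_tangent [seq v - w | v <- s, w <- s] d2 x1.
pose p v := dotv v x +i* dotv v e.
have p_inj : {in s &, injective p}.
  move=> v w vs ws [vx ve]; apply/eqP; rewrite -subr_eq0.
  apply/negPn/negP => n0.
  have := es _ (allpairs_f (fun v w => v - w) vs ws) n0.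
  by rewrite ![dotv (v - w) _]dotvC !dotvBr ![dotv _ v]dotvC ![dotv _ w]dotvC
    vx ve !subrr eqxx => /(_ erefl).
(* The index lookup inverts p on [map p s]; the default 0 is not reached there. *)
pose A q := (C (nth 0 s (index q (map p s))))%:P.
have A0 : vanishes_near0 (map p s) A.
  apply: filterS (near_great_circle e Uo Ux) => t Ut.
  have Tt : Theta (cos t *: x + sin t *: e).
    rewrite TU; split=> //; apply/unit_sphereE.
    rewrite dotvDr !dotvZr ![dotv (_ + _) _]dotvC !dotvDr !dotvZr.
    rewrite x1 e1 [dotv e x]dotvC xe !mulr0 addr0 add0r !mulr1 -!expr2.
    exact: cos2Dsin2.
  rewrite big_map -[RHS](Cs _ Tt) !big_seq; apply: eq_bigr => v vs.
  rewrite /A nth_index_map // hornerC cexp_i dotvDr !dotvZr /phase /=.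
  by rewrite ![_ * dotv _ _]mulrC.
move=> v vs; have := circle_independence _ A0 (map_f p vs).
rewrite map_inj_in_uniq // => /(_ us) /eqP.
by rewrite /A nth_index_map // polyC_eq0 => /eqP.
Qed.

End Sphere.

(** * Comparison of the two exponential sums *)

Lemma sum_fiber (R : comNzRingType) (T : eqType) (n : nat) (y : 'I_n -> T)
    (c : 'I_n -> R) (f : T -> R) (s : seq T) :
  uniq s -> (forall j, y j \in s) ->
  \sum_(x <- s) (\sum_(j | y j == x) c j) * f x = \sum_j c j * f (y j).
Proof.
move=> us ys; under eq_bigr do rewrite mulr_suml big_mkcond.
rewrite exchange_big; apply: eq_bigr => j _ /=.
rewrite (bigD1_seq (y j)) //= eqxx big1 ?addr0 // => x /negPf.
by rewrite eq_sym => ->.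
Qed.

(** The difference of the two sums is a single sum over the union of the points, so its coefficient
    at each y_j vanishes; as c_j is nonzero, some z_k must equal y_j. One-sided, to be used in both
    directions. *)
Lemma exp_sum_matching (R : realType) (d : nat) (Theta : set 'rV[R]_d)
    (n m : nat) (y : 'I_n -> 'rV[R]_d) (c : 'I_n -> R[i])
    (z : 'I_m -> 'rV[R]_d) (b : 'I_m -> R[i]) : (2 <= d)%N ->
  Theta !=set0 -> relatively_open (unit_sphere R d) Theta ->
  injective y -> injective z -> (forall j, c j != 0) ->
  (forall theta, Theta theta -> exp_sum y c theta = exp_sum z b theta) ->
  forall j, exists2 k, z k = y j & b k = c j.
Proof.
move=> d2 T0 To y_inj z_inj c0 yz j.
pose s := undup (codom y ++ codom z).
have ys i : y i \in s by rewrite mem_undup mem_cat codom_f.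
have zs i : z i \in s by rewrite mem_undup mem_cat codom_f orbT.
have us : uniq s by exact: undup_uniq.
have := @sphere_independence _ _ _ _
  (fun x => \sum_(i | y i == x) c i - \sum_(i | z i == x) b i)
  d2 T0 To us _ (y j) (ys j).
rewrite (big_pred1 j) => [C0|i /=]; last by rewrite (inj_eq y_inj).
have {C0}/eqP : c j - \sum_(i | z i == y j) b i = 0.
  apply: C0 => theta /yz; rewrite /exp_sum => e.
  under eq_bigr do rewrite mulrBl.
  pose f x := cexp ('i%C * (dotv x theta)%:C).
  rewrite sumrB (sum_fiber c f us ys) (sum_fiber b f us zs).
  by apply/eqP; rewrite subr_eq0; apply/eqP.
rewrite subr_eq0 => /eqP cj.
case: (pickP (fun k => z k == y j)) => [k /eqP zk|no]; last first.
  by have := c0 j; rewrite cj big_pred0 ?eqxx.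
exists k => //; rewrite cj (big_pred1 k) // => i /=.
by rewrite -zk (inj_eq z_inj).
Qed.

Theorem proposition3p1 (R : realType) (d : nat) (hd : (2 <= d)%N)
  (Theta : set 'rV[R]_d) (Theta_neq0 : Theta !=set0)
  (Theta_open : relatively_open (unit_sphere R d) Theta)
  (n m : nat)
  (y : 'I_n -> 'rV[R]_d) (y_inj : injective y)
  (c : 'I_n -> R[i]) (c_neq0 : forall j, c j != 0)
  (z : 'I_m -> 'rV[R]_d) (z_inj : injective z)
  (b : 'I_m -> R[i]) (b_neq0 : forall j, b j != 0)
  (eq_Theta : forall theta, Theta theta ->
     exp_sum y c theta = exp_sum z b theta) :
  [set (y j, c j) | j in [set: 'I_n]] = [set (z j, b j) | j in [set: 'I_m]]
  /\ n = m.
Proof.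
have yz := exp_sum_matching hd Theta_neq0 Theta_open y_inj z_inj c_neq0 eq_Theta.
have zy := exp_sum_matching hd Theta_neq0 Theta_open z_inj y_inj b_neq0
  (fun theta Tt => esym (eq_Theta theta Tt)).
(* A choice of matching indices is injective because [u] is; both directions give n = m. *)
have le (k l : nat) (u : 'I_k -> 'rV[R]_d) (v : 'I_l -> 'rV[R]_d)
    (a : 'I_k -> R[i]) (e : 'I_l -> R[i]) : injective u ->
    (forall i, exists2 j, v j = u i & e j = a i) -> (k <= l)%N.
  move=> u_inj uv.
  have uv' i : exists j, v j = u i by have [j] := uv i; exists j.
  have [g gP] := boolp.choice uv'.
  rewrite -(card_ord k) -(card_ord l); apply: (leq_card g) => i i' gi.
  by apply: u_inj; rewrite -!gP gi.
split; last by apply/eqP; rewrite eqn_leq (le _ _ _ _ _ _ y_inj yz)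
  (le _ _ _ _ _ _ z_inj zy).
rewrite eqEsubset; split=> _ [j _ <-].
- by have [k <- <-] := yz j; exists k.
- by have [k <- <-] := zy j; exists k.
Qed.
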